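(* Let $f:\mathbb R_+\to\mathbb R_+$ be a function having the representation $f(s)=\langle A|e^{-sB}\rangle$, where $A,B\in\mathbb R^{p\times p}$ for some $p\ge1$ and $B$ has eigenvalues with positive real parts. Then $f$ is a (finite, real) linear combination of functions of the form $$u(s)=P(s)\big(1+c\cos(\xi s)+d\sin(\xi s)\big)e^{-rs},$$ where $P(s)=\sum_{k=0}^{m}a_ks^k$ is a real polynomial, $\xi,c,d\ge0$ and $r>0$. Conversely, for every function $u$ of this form there exist two real square matrices $A_u$ and $B_u$ of the same size such that $u(s)=\langle A_u|e^{-sB_u}\rangle$ for all $s\ge0$, and such that $B_u$ has eigenvalues with positive real parts.
   Context: $\langle\cdot|\cdot\rangle$ denotes the canonical inner product on real square matrices, $\langle A|M\rangle=\sum_{i,j}A_{ij}M_{ij}$. *)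

(* Defs.v *)
From HB Require Import structures.
From mathcomp Require Import all_boot all_order all_algebra.
From mathcomp Require Import complex.
From mathcomp Require Import all_classical all_reals all_analysis.

Set Implicit Arguments.
Unset Strict Implicit.
Unset Printing Implicit Defensive.

Import Order.TTheory GRing.Theory Num.Theory.
Import numFieldNormedType.Exports.
Local Open Scope classical_set_scope.
Local Open Scope ring_scope.

Definition mxdot (R : realType) (p : nat) (A M : 'M[R]_p) : R :=
  \sum_(i < p) \sum_(j < p) A i j * M i j.

(* The limit is taken in the normed space of matrices (sup norm). *)
Definition expmx (R : realType) (p : nat) (M : 'M[R]_p) : 'M[R]_p :=
  limn (series (fun k : nat => (k`!%:R : R)^-1 *: (M ^+ k : 'M[R]_p))).

(* Eigenvalues are complex: B is viewed as a matrix over R[i]. *)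
Definition eigenvalues_pos_re (R : realType) (p : nat) (B : 'M[R]_p) : Prop :=
  forall z : R[i],
    eigenvalue (map_mx (real_complex R) B) z -> 0 < complex.Re z.

(* Functions on R_+ are encoded as functions on R considered on s >= 0 only. *)
Definition poly_trig_exp (R : realType) (u : R -> R) : Prop :=
  exists (P : {poly R}) (xi c d r : R),
    [/\ 0 <= xi, 0 <= c, 0 <= d, 0 < r &
      forall s : R, 0 <= s ->
        u s = P.[s] * (1 + c * cos (xi * s) + d * sin (xi * s))
              * expR (- (r * s))].

(* Main.v *)
(* A function s |-> <A|e^(-sB)> is the exponential generating function
   sum_k a_k s^k / k! of the sequence a_k = <A|(-B)^k>.  By Cayley-Hamilton this
   sequence satisfies the linear recurrence whose characteristic polynomial is
   char_poly (-B); splitting that polynomial over R[i] and solving the recurrence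
   one root at a time shows that a is a combination of the sequences
   k (k-1) ... (k-j+1) z^(k-j), whose generating functions are s^j e^(z s), where
   z runs over the eigenvalues of -B.  Taking real parts yields the span.
   Conversely the coefficient sequence of u satisfies the real recurrence with
   characteristic polynomial ((X + r) ((X + r)^2 + xi^2))^m, so it is realized by
   the companion matrix of that polynomial, whose eigenvalues have real part -r. *)
Require Import Defs.
From HB Require Import structures.
From mathcomp Require Import all_boot all_order all_algebra.
From mathcomp Require Import complex.
From mathcomp Require Import all_classical all_reals all_analysis.
From mathcomp Require Import ring.

Set Implicit Arguments.
Unset Strict Implicit.
Unset Printing Implicit Defensive.

Import Order.TTheory GRing.Theory Num.Theory.
Import numFieldNormedType.Exports.
Local Open Scope classical_set_scope.
Local Open Scope ring_scope.

(** * Linear recurrences and their polynomial-exponential solutions *)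

Section Recurrences.
Variable K : numFieldType.
Implicit Types (a b : nat -> K) (q : {poly K}).

(** The linear functional on polynomials that sends ['X^k] to [a k]. A recurrence with
    characteristic polynomial [chi] means that it kills all multiples of [chi]. *)
Definition seq_eval a q : K := \sum_(i < size q) q`_i * a i.

Lemma seq_eval_widen n a q : (size q <= n)%N ->
  seq_eval a q = \sum_(i < n) q`_i * a i.
Proof.
move=> le_qn; rewrite /seq_eval (big_ord_widen n (fun i => q`_i * a i)) //.
rewrite big_mkcond; apply: eq_bigr => i _; case: ltnP => // le_qi.
by rewrite nth_default // mul0r.
Qed.

Lemma seq_eval_Xn a k : seq_eval a 'X^k = a k.
Proof.
rewrite /seq_eval size_polyXn big_ord_recr /= coefXn eqxx mul1r big1 ?add0r //.
by move=> i _; rewrite coefXn (ltn_eqF (ltn_ord i)) mul0r.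
Qed.

(** The operator S - l, where S is the shift; on generating functions it acts as d/ds - l. *)
Definition shift_sub (l : K) a (k : nat) : K := a k.+1 - l * a k.

Lemma seq_eval_shift_sub l a q :
  seq_eval (shift_sub l a) q = seq_eval a (('X - l%:P) * q).
Proof.
have sz : (size (('X - l%:P) * q)%R <= (size q).+1)%N.
  by rewrite (leq_trans (size_polyMleq _ _)) // size_XsubC.
rewrite (seq_eval_widen _ sz).
under [RHS]eq_bigr do rewrite mulrBl coefB coefXM coefCM mulrBl.
rewrite sumrB big_ord_recl [X in _ - X]big_ord_recr /= mul0r add0r.
rewrite [X in _ - (_ + X)](_ : _ = 0); last by rewrite nth_default // mulr0 mul0r.
rewrite addr0 -sumrB; apply: eq_bigr => i _.
by rewrite /shift_sub mulrBr mulrCA mulrA.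
Qed.

(* The exponential generating function of [exp_seq l j] is [s^j e^(l s)]. *)
Definition exp_seq (l : K) (j k : nat) : K := (k ^_ j)%:R * l ^+ (k - j).

(** This is the product rule for s^j e^(m s). At [j = 0] the factor [j%:R] hides the truncated
    [j.-1]. *)
Lemma shift_sub_exp_seq l m j k :
  shift_sub l (exp_seq m j) k =
    j%:R * exp_seq m j.-1 k + (m - l) * exp_seq m j k.
Proof.
suff E : exp_seq m j k.+1 = j%:R * exp_seq m j.-1 k + m * exp_seq m j k.
  by rewrite /shift_sub E mulrBl addrA.
rewrite /exp_seq; case: j => [|j] /=.
  by rewrite !ffactn0 !subn0 exprS mul0r add0r mulrCA.
have [lt_jk|] := ltnP j k; last first.
  rewrite leq_eqVlt => /orP[/eqP->|lt_kj].
    by rewrite subSS subnn ffactSS [j ^_ j.+1]ffact_small // natrM; ring.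
  rewrite [k.+1 ^_ _]ffact_small // [k ^_ j]ffact_small //.
  by rewrite [k ^_ j.+1]ffact_small 1?ltnW //; ring.
rewrite subSS ffactSS ffactnSr -(subnSK lt_jk) exprS !natrM.
have -> : k.+1%:R = j.+1%:R + (k - j.+1).+1%:R :> K.
  by rewrite -natrD addnS subnKC.
ring.
Qed.

(** Each factor ['X - l%:P] lowers [j] by one up to a scalar, and the last one kills the geometric
    sequence. *)
Lemma seq_eval_exp_seq l j q : seq_eval (exp_seq l j) (('X - l%:P) ^+ j.+1 * q) = 0.
Proof.
elim: j q => [|j IHj] q; rewrite exprS -mulrA -seq_eval_shift_sub.
  by rewrite /seq_eval big1 // => i _; rewrite shift_sub_exp_seq subrr !mul0r addr0 mulr0.
transitivity (j.+1%:R * seq_eval (exp_seq l j) (('X - l%:P) ^+ j.+1 * q)).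
  rewrite /seq_eval mulr_sumr; apply: eq_bigr => i _.
  by rewrite shift_sub_exp_seq subrr mul0r addr0 mulrCA.
by rewrite IHj mulr0.
Qed.

(** Inductive, so that proofs add one term at a time; [P] confines the exponents, later to the open
    left half-plane. *)
Inductive exp_sum (P : K -> Prop) : (nat -> K) -> Prop :=
| exp_sum0 : exp_sum P (fun=> 0)
| exp_sum_add c l j b of P l & exp_sum P b :
    exp_sum P (fun k => c * exp_seq l j k + b k).

Lemma exp_sumD P a b :
  exp_sum P a -> exp_sum P b -> exp_sum P (fun k => a k + b k).
Proof.
move=> Pa Pb; elim: Pa => [|c l j a' Pl _ IHa].
  by rewrite [X in exp_sum P X](_ : _ = b) //; apply/funext => k; rewrite add0r.
rewrite [X in exp_sum P X](_ : _ = fun k => c * exp_seq l j k + (a' k + b k)).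
  exact: exp_sum_add.
by apply/funext => k; rewrite addrA.
Qed.

Lemma exp_sum1 (P : K -> Prop) c l j : P l -> exp_sum P (fun k => c * exp_seq l j k).
Proof.
move=> Pl; rewrite [X in exp_sum P X](_ : _ = fun k => c * exp_seq l j k + 0).
  exact: exp_sum_add Pl (exp_sum0 P).
by apply/funext => k; rewrite addr0.
Qed.

(** If [l = m] (resonance), the degree [j] rises by one and [j.+1] is inverted. Otherwise dividing
    by [m - l] leaves an error of degree one less, which the induction on [j] removes. *)
Lemma exp_sum_solve1 (P : K -> Prop) c l m j : P m ->
  exists2 a, exp_sum P a & forall k, shift_sub l a k = c * exp_seq m j k.
Proof.
move=> Pm; have [->|ne_ml] := eqVneq l m.
  exists (fun k => c / j.+1%:R * exp_seq m j.+1 k); first exact: exp_sum1.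
  move=> k; have := shift_sub_exp_seq m m j.+1 k; rewrite /shift_sub /= subrr => E.
  rewrite [m * _]mulrCA -mulrBr E mul0r addr0 mulrA.
  by rewrite divfK ?pnatr_eq0.
have nz : m - l != 0 by rewrite subr_eq0 eq_sym.
elim: j c => [|j IHj] c.
  exists (fun k => c / (m - l) * exp_seq m 0 k); first exact: exp_sum1.
  move=> k; have := shift_sub_exp_seq l m 0 k; rewrite /shift_sub /= mul0r add0r => E.
  by rewrite [l * _]mulrCA -mulrBr E mulrA divfK.
have [a Pa Ea] := IHj (- (c / (m - l) * j.+1%:R)).
exists (fun k => c / (m - l) * exp_seq m j.+1 k + a k); first exact: exp_sum_add.
move=> k; have := shift_sub_exp_seq l m j.+1 k; have := Ea k.
rewrite /shift_sub /= => E1 E2.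
rewrite mulrDr [l * (_ * exp_seq _ _ _)]mulrCA opprD addrACA E1 -mulrBr E2 mulrDr.
by rewrite [X in _ + X + _](mulrA (c / _)) divfK // mulrA mulNr addrAC addrN add0r.
Qed.

Lemma exp_sum_solve P l b : exp_sum P b ->
  exists2 a, exp_sum P a & forall k, shift_sub l a k = b k.
Proof.
elim=> [|c m j b' Pm _ [a Pa Ea]].
  by exists (fun=> 0); [exact: exp_sum0 | move=> k; rewrite /shift_sub mulr0 subrr].
have [a' Pa' Ea'] := exp_sum_solve1 c l j Pm.
exists (fun k => a' k + a k); first exact: exp_sumD.
by move=> k; rewrite -Ea -Ea' /shift_sub mulrDr opprD addrACA.
Qed.

(** Induction on the roots: S - z turns [a] into a solution for the remaining roots, and that
    equation is then solved back for [a]. *)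
Lemma exp_sum_recurrence (P : K -> Prop) (rs : seq K) a :
    (forall z, z \in rs -> P z) ->
    (forall q, seq_eval a ((\prod_(z <- rs) ('X - z%:P)) * q) = 0) ->
  exp_sum P a.
Proof.
elim: rs a => [|z rs IHrs] a Prs a0.
  rewrite (_ : a = fun=> 0); first exact: exp_sum0.
  by apply/funext => k; have := a0 'X^k; rewrite big_nil mul1r seq_eval_Xn.
have [|a' Pa' Ea'] := @exp_sum_solve P z (shift_sub z a).
  apply: IHrs => [x xrs|q]; first by apply: Prs; rewrite inE xrs orbT.
  by have := a0 q; rewrite big_cons -mulrA seq_eval_shift_sub.
(* The difference of [a] and [a'] is killed by S - z, hence geometric of ratio [z]. *)
rewrite (_ : a = fun k => (a 0%N - a' 0%N) * exp_seq z 0 k + a' k).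
  by apply: exp_sum_add => //; apply: Prs; rewrite mem_head.
apply/funext => k; apply/eqP; rewrite -subr_eq; apply/eqP.
rewrite /exp_seq ffactn0 mul1r subn0.
elim: k => [|k IHk]; first by rewrite mulr1.
rewrite exprS mulrCA -IHk; have := Ea' k; rewrite /shift_sub => E.
apply/eqP; rewrite -subr_eq0; apply/eqP.
transitivity (a k.+1 - z * a k - (a' k.+1 - z * a' k)); first by ring.
by rewrite E subrr.
Qed.

End Recurrences.

(** * Exponential generating functions on the real line *)

Section ExponentialGeneratingFunctions.
Variable R : realType.
Implicit Types (a b : nat -> R) (u v : R -> R).

Definition egf_coeff a (k : nat) : R := a k / k`!%:R.

(** A relation that includes convergence everywhere, so that equality of sequences yields equality
    of functions by uniqueness of limits. *)
Definition has_egf a u : Prop :=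
  forall s : R, pseries (egf_coeff a) s @ \oo --> u s.

Definition egf a (s : R) : R := limn (pseries (egf_coeff a) s).

Definition exp_bounded a : Prop :=
  exists C M : R, [/\ 0 <= C, 0 <= M & forall k, `|a k| <= C * M ^+ k].

Lemma has_egf_unique a u v s : has_egf a u -> has_egf a v -> u s = v s.
Proof. by move=> /(_ s) au /(_ s) av; exact: cvg_unique au av. Qed.

Lemma has_egf0 : has_egf (fun=> 0) (fun=> 0).
Proof.
move=> s; rewrite [X in X @ _](_ : _ = fun=> 0); first exact: cvg_cst.
apply/funext => n; rewrite /pseries /series /= big1 // => k _.
by rewrite /egf_coeff !mul0r.
Qed.

Lemma has_egfD a b u v : has_egf a u -> has_egf b v ->
  has_egf (fun k => a k + b k) (fun s => u s + v s).
Proof.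
move=> au bv s.
rewrite [X in X @ _](_ : _ = pseries (egf_coeff a) s + pseries (egf_coeff b) s);
  first exact: cvgD (au s) (bv s).
apply/funext => n; rewrite /pseries /series /= fctE -big_split /=.
by apply: eq_bigr => k _; rewrite /egf_coeff; ring.
Qed.

Lemma has_egfZ c a u : has_egf a u ->
  has_egf (fun k => c * a k) (fun s => c * u s).
Proof.
move=> au s.
rewrite [X in X @ _](_ : _ = fun n => c * pseries (egf_coeff a) s n);
  first exact: cvgMr (au s).
apply/funext => n; rewrite /pseries /series /= mulr_sumr.
by apply: eq_bigr => k _; rewrite /egf_coeff; ring.
Qed.

Lemma has_egf_sum (I : finType) (a : I -> nat -> R) (u : I -> R -> R) :
    (forall i, has_egf (a i) (u i)) ->
  has_egf (fun k => \sum_i a i k) (fun s => \sum_i u i s).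
Proof.
move=> au; suff H r : has_egf (fun k => \sum_(i <- r) a i k)
                              (fun s => \sum_(i <- r) u i s) by exact: H.
elim: r => [|i r IHr].
  have := has_egf0; congr has_egf; apply/funext => k; exact/esym/big_nil.
have := has_egfD (au i) IHr.
by congr has_egf; apply/funext => k; rewrite big_cons.
Qed.

(** The first [n.+1] terms of the new series sum to [s] times the first [n] of the old one. *)
Lemma has_egfMX a u : has_egf a u ->
  has_egf (fun k => k%:R * a k.-1) (fun s => s * u s).
Proof.
move=> au s; rewrite -cvg_shiftS.
rewrite [X in X @ _](_ : _ = fun n => s * pseries (egf_coeff a) s n);
  first exact: cvgMr (au s).
apply/funext => n; rewrite /pseries /series /= big_nat_recl //.
rewrite {1}/egf_coeff !mul0r add0r mulr_sumr; apply: eq_bigr => k _.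
have k0 : k.+1%:R != 0 :> R by rewrite pnatr_eq0.
have f0 : k`!%:R != 0 :> R by rewrite pnatr_eq0 -lt0n fact_gt0.
rewrite /egf_coeff factS natrM exprS /=; move: k.+1%:R k`!%:R k0 f0 => x y x0 y0.
by field; rewrite x0 y0.
Qed.

Lemma exp_bounded_shift a : exp_bounded a -> exp_bounded (fun k => a k.+1).
Proof.
move=> [C [M [C0 M0 aCM]]]; exists (C * M), M; split=> [||k] //.
  exact: mulr_ge0.
by rewrite -mulrA -exprS.
Qed.

(** Comparison with [C] times the exponential series at [M * |s|]. *)
Lemma exp_bounded_egf a : exp_bounded a -> has_egf a (egf a).
Proof.
move=> [C [M [C0 M0 aCM]]] s.
suff : cvgn (pseries (egf_coeff a) s) by [].
rewrite /pseries; apply: normed_cvg.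
apply: (@series_le_cvg _ _ (C *: exp_coeff (M * `|s|))) => [k|k|k|].
- exact: normr_ge0.
- by rewrite mulr_ge0 // divr_ge0 // exprn_ge0 // mulr_ge0.
- rewrite /= /egf_coeff !normrM normfV normrX normr_nat.
  rewrite /exp_coeff fctE /= exprMn [leRHS](_ : _ =
    C * M ^+ k * (k`!%:R^-1 * `|s| ^+ k)); last by rewrite /GRing.scale /=; ring.
  by rewrite -mulrA ler_wpM2r // mulr_ge0 // exprn_ge0.
- exact/is_cvg_seriesZ/is_cvg_series_exp_coeff.
Qed.

Lemma egf0 a : exp_bounded a -> egf a 0 = a 0%N.
Proof.
move=> /exp_bounded_egf /(_ 0) ae; apply: (cvg_unique _ ae) => //=.
rewrite -cvg_shiftS [X in X @ _](_ : _ = fun=> a 0%N); first exact: cvg_cst.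
apply/funext => n; rewrite /pseries /series /= big_nat_recl //= big1.
  by rewrite /egf_coeff expr0 fact0 divr1 mulr1 addr0.
by move=> k _; rewrite expr0n mulr0.
Qed.

(** Formal derivation shifts [a], and shifts keep exponential bounds; so the series and its two
    formal derivatives converge at [|s| + 1], beyond [|s|], as termwise differentiation requires. *)
Lemma is_derive_egf a (s : R) : exp_bounded a ->
  is_derive s 1 (egf a) (egf (fun k => a k.+1) s).
Proof.
have diffs b : pseries_diffs (egf_coeff b) = egf_coeff (fun k => b k.+1).
  apply/funext => k; rewrite /pseries_diffs /egf_coeff factS natrM.
  have k0 : k.+1%:R != 0 :> R by rewrite pnatr_eq0.
  have f0 : k`!%:R != 0 :> R by rewrite pnatr_eq0 -lt0n fact_gt0.
  move: k.+1%:R k`!%:R k0 f0 => x y x0 y0.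
  by field; rewrite x0 y0.
move=> a0; have a1 := exp_bounded_shift a0; have a2 := exp_bounded_shift a1.
rewrite /egf -diffs; apply: (@pseries_snd_diffs _ _ (`|s| + 1)).
- by apply: cvgP; exact: exp_bounded_egf.
- by rewrite diffs; apply: cvgP; exact: exp_bounded_egf.
- by rewrite !diffs; apply: cvgP; exact: exp_bounded_egf.
- by rewrite [ltRHS]ger0_norm ?addr_ge0 // ltrDl.
Qed.

End ExponentialGeneratingFunctions.

(** * Complex exponentials through real and imaginary parts *)

Section ComplexExponential.
Variable R : realType.
Implicit Types (z w : R[i]).

Lemma complex_ReD z w : complex.Re (z + w) = complex.Re z + complex.Re w.
Proof. by case: z w => [? ?] [? ?]. Qed.

Lemma complex_ReM z w : complex.Re (z * w) =
  complex.Re z * complex.Re w - complex.Im z * complex.Im w.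
Proof. by case: z w => [? ?] [? ?]. Qed.

Lemma complex_ImM z w : complex.Im (z * w) =
  complex.Re z * complex.Im w + complex.Im z * complex.Re w.
Proof. by case: z w => [? ?] [? ?]. Qed.

Lemma complex_ReMn n z : complex.Re (n%:R * z) = n%:R * complex.Re z.
Proof. by rewrite -(rmorph_nat (real_complex R)) complex_ReM /= mul0r subr0. Qed.

(** The bound [M] is the l1 norm of [z], which is submultiplicative. *)
Lemma ReIm_exp_bounded z :
  exp_bounded (fun k => complex.Re (z ^+ k)) /\
  exp_bounded (fun k => complex.Im (z ^+ k)).
Proof.
set M := `|complex.Re z| + `|complex.Im z|.
have M0 : 0 <= M by rewrite addr_ge0.
suff B k : `|complex.Re (z ^+ k)| <= M ^+ k /\ `|complex.Im (z ^+ k)| <= M ^+ k.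
  by split; exists 1, M; split=> // k; rewrite mul1r; have [] := B k.
elim: k => [|k [IHr IHi]]; first by rewrite !expr0 /= normr1 normr0.
rewrite !exprS complex_ReM complex_ImM /M mulrDl; split.
  by rewrite (le_trans (ler_normB _ _)) // !normrM lerD // ler_wpM2l.
by rewrite (le_trans (ler_normD _ _)) // !normrM lerD // ler_wpM2l.
Qed.

(** The generating functions F and G satisfy (F + iG)' = z (F + iG) with value 1 at 0, which forces
    F + iG = e^(z s). *)
Lemma has_egf_ReIm_exp z (x := complex.Re z) (y := complex.Im z) :
  has_egf (fun k => complex.Re (z ^+ k)) (fun s => expR (x * s) * cos (y * s)) /\
  has_egf (fun k => complex.Im (z ^+ k)) (fun s => expR (x * s) * sin (y * s)).
Proof.
have [bF bG] := ReIm_exp_bounded z.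
set F := egf (fun k => complex.Re (z ^+ k)).
set G := egf (fun k => complex.Im (z ^+ k)).
have hF : has_egf _ F := exp_bounded_egf bF.
have hG : has_egf _ G := exp_bounded_egf bG.
have dF (s : R) : is_derive s 1 F (x * F s - y * G s).
  apply: is_derive_eq; first exact: is_derive_egf.
  rewrite -mulNr; apply: (has_egf_unique (u := egf _)
    (v := fun s => x * F s + - y * G s));
    first exact: exp_bounded_egf (exp_bounded_shift bF).
  have := has_egfD (has_egfZ (c := x) hF) (has_egfZ (c := (- y)) hG).
  by congr has_egf; apply/funext => k; rewrite exprS complex_ReM mulNr.
have dG (s : R) : is_derive s 1 G (x * G s + y * F s).
  apply: is_derive_eq; first exact: is_derive_egf.
  apply: (has_egf_unique (u := egf _)
    (v := fun s => x * G s + y * F s));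
    first exact: exp_bounded_egf (exp_bounded_shift bG).
  have := has_egfD (has_egfZ (c := x) hG) (has_egfZ (c := y) hF).
  by congr has_egf; apply/funext => k; rewrite exprS complex_ImM.
pose e (s : R) := expR (- x * s).
pose c (s : R) := cos (y * s).
pose d (s : R) := sin (y * s).
have dlin (r s : R) : is_derive s 1 ( *%R r) r.
  by apply: is_derive_eq; rewrite /GRing.scale /= mulr1.
have de (s : R) : is_derive s 1 e (- x * e s).
  rewrite mulrC; exact: (is_derive1_comp (is_derive_expR _) (dlin _ _)).
have dc (s : R) : is_derive s 1 c (- y * d s).
  rewrite mulNr mulrC -mulNr.
  exact: (is_derive1_comp (is_derive_cos _) (dlin _ _)).
have dd (s : R) : is_derive s 1 d (y * c s).
  rewrite mulrC; exact: (is_derive1_comp (is_derive_sin _) (dlin _ _)).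
have F0 : F 0 = 1 by rewrite /F egf0.
have G0 : G 0 = 0 by rewrite /G egf0.
(* e^(-zs) (F + iG) is constant; H and K are its real and imaginary parts. *)
have H s : e s * (F s * c s + G s * d s) = 1.
  have -> : 1 = (e * (F * c + G * d)) 0.
    by rewrite !fctE /e /c /d !mulr0 expR0 cos0 sin0 F0; ring.
  apply: (@is_derive_0_is_cst _ (e * (F * c + G * d))) => t.
  by apply: is_derive_eq; rewrite /GRing.scale /= !fctE; ring.
have K s : e s * (G s * c s - F s * d s) = 0.
  have -> : 0 = (e * (G * c - F * d)) 0.
    by rewrite !fctE /e /c /d !mulr0 expR0 cos0 sin0 G0; ring.
  apply: (@is_derive_0_is_cst _ (e * (G * c - F * d))) => t.
  by apply: is_derive_eq; rewrite /GRing.scale /= !fctE; ring.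
have E s : expR (x * s) * e s = 1 by rewrite /e mulNr expRxMexpNx_1.
have C s : c s ^+ 2 + d s ^+ 2 = 1 by rewrite /c /d cos2Dsin2.
(* Solve [H] and [K] for F and G; the determinant of the rotation is 1 by [C]. *)
split.
  rewrite (_ : (fun s => _) = F) //; apply/funext => s.
  rewrite -/(c s) -[RHS]mul1r -(E s) -[LHS]mulr1 -(H s).
  have -> : expR (x * s) * e s * F s = expR (x * s) * (e s * F s * 1) by ring.
  rewrite -(C s); transitivity (expR (x * s) * c s * (e s * (F s * c s + G s * d s)) -
     expR (x * s) * d s * (e s * (G s * c s - F s * d s))).
    by rewrite K; ring.
  by ring.
rewrite (_ : (fun s => _) = G) //; apply/funext => s.
rewrite -/(d s) -[RHS]mul1r -(E s) -[LHS]mulr1 -(H s).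
have -> : expR (x * s) * e s * G s = expR (x * s) * (e s * G s * 1) by ring.
rewrite -(C s); transitivity (expR (x * s) * d s * (e s * (F s * c s + G s * d s)) +
   expR (x * s) * c s * (e s * (G s * c s - F s * d s))).
  by rewrite K; ring.
by ring.
Qed.

(** The function is the real part of c s^j e^(z s); each induction step multiplies by [s]. *)
Lemma has_egf_Re_exp_seq (c z : R[i]) j :
  has_egf (fun k => complex.Re (c * exp_seq z j k))
    (fun s => s ^+ j * (expR (complex.Re z * s) *
       (complex.Re c * cos (complex.Im z * s) - complex.Im c * sin (complex.Im z * s)))).
Proof.
elim: j => [|j IHj].
  have [hr hi] := has_egf_ReIm_exp z.
  have := has_egfD (has_egfZ (c := complex.Re c) hr)
    (has_egfZ (c := - complex.Im c) hi).
  congr has_egf; apply/funext => k.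
    by rewrite /exp_seq ffactn0 mul1r subn0 complex_ReM mulNr.
  by ring.
have := has_egfMX IHj; congr has_egf; apply/funext => k; last by rewrite exprS mulrA.
rewrite -complex_ReMn mulrCA; congr (complex.Re (_ * _)).
case: k => [|k]; first by rewrite /exp_seq ffact0n !mul0r.
by rewrite /exp_seq ffactSS subSS natrM mulrA.
Qed.

End ComplexExponential.

(** * The matrix exponential, entry by entry *)

Section MatrixExponential.
Variables (R : realType) (p : nat).
Implicit Types (A N : 'M[R]_p).

(** [M] sums the absolute values of all entries, so it dominates each row sum, hence the operator
    norm for the sup norm. *)
Lemma exp_bounded_mx N i j : exp_bounded (fun k => (N ^+ k) i j).
Proof.
pose r i := \sum_j `|N i j|; pose M := \sum_i r i.
have r0 i' : 0 <= r i' by exact: sumr_ge0.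
have M0 : 0 <= M by exact: sumr_ge0.
have rM i' : r i' <= M by rewrite /M (bigD1 i') //= lerDl sumr_ge0.
exists 1, M; split => // k; rewrite mul1r.
elim: k i => [|k IHk] i; first by rewrite expr0 mxE; case: eqP; rewrite ?normr1 ?normr0.
rewrite exprS -[N * _]/(N *m _) mxE (le_trans (ler_norm_sum _ _ _)) //.
apply: (@le_trans _ _ (r i * M ^+ k)); last by rewrite exprS ler_wpM2r ?exprn_ge0.
rewrite /r mulr_suml; apply: ler_sum => l _.
by rewrite normrM ler_wpM2l.
Qed.

Lemma expr_scalemx N (s : R) k : (s *: N) ^+ k = s ^+ k *: (N ^+ k).
Proof.
elim: k => [|k IHk]; first by rewrite !expr0 scale1r.
by rewrite !exprS IHk -[LHS]/(_ *m _) -scalemxAl -scalemxAr scalerA.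
Qed.

Lemma expmx_entry N (s : R) i j :
  expmx (s *: N) i j = egf (fun k => (N ^+ k) i j) s.
Proof.
pose E := \matrix_(i, j) egf (fun k => (N ^+ k) i j) s.
suff -> : expmx (s *: N) = E by rewrite mxE.
apply: cvg_lim; first exact: norm_hausdorff.
(* A neighbourhood of a matrix contains a product of neighbourhoods of its finitely many entries, so
   entrywise convergence suffices. *)
move=> Q [V nV sV].
have H : \forall n \near \oo, forall ij : 'I_p * 'I_p, V ij.1 ij.2
    (series (fun k => (k`!%:R : R)^-1 *: ((s *: N) ^+ k : 'M[R]_p)) n ij.1 ij.2).
  apply: filter_forall => -[k l] /=.
  have C : has_egf _ _ := exp_bounded_egf (exp_bounded_mx N k l).
  have := nV k l; rewrite mxE => /(C s).
  rewrite [pseries _ s](_ : _ = fun n =>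
    series (fun k => (k`!%:R : R)^-1 *: ((s *: N) ^+ k : 'M[R]_p)) n k l) //.
  apply/funext => n; rewrite /pseries /series /= summxE.
  by apply: eq_bigr => m _; rewrite expr_scalemx !mxE /egf_coeff; ring.
by apply: filterS H => n Hn; apply: sV => k l; exact: (Hn (k, l)).
Qed.

Lemma has_egf_mxdot A N :
  has_egf (fun k => mxdot A (N ^+ k)) (fun s => mxdot A (expmx (s *: N))).
Proof.
apply: has_egf_sum => i; apply: has_egf_sum => j; apply: has_egfZ.
rewrite (_ : (fun s => _) = egf (fun k => (N ^+ k) i j)).
  exact/exp_bounded_egf/exp_bounded_mx.
by apply/funext => s; rewrite expmx_entry.
Qed.

End MatrixExponential.

(** * The recurrence given by Cayley-Hamilton *)

Lemma eigenvalue_opp (K : fieldType) n (A : 'M[K]_n) z :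
  eigenvalue (- A) z = eigenvalue A (- z).
Proof.
apply/eigenvalueP/eigenvalueP => -[v vA v0]; exists v => //.
  by rewrite scaleNr -vA mulmxN opprK.
by rewrite mulmxN vA scaleNr opprK.
Qed.

(** Expand q(N) in powers of N. The pairing is spelled out as a double sum because it is used over
    [R[i]], while [mxdot] is real. *)
Lemma seq_eval_mx (K : numFieldType) n (A N : 'M[K]_n.+1) q :
  seq_eval (fun k => \sum_i \sum_j A i j * (N ^+ k) i j) q =
  \sum_i \sum_j A i j * horner_mx N q i j.
Proof.
have -> : horner_mx N q = \sum_(k < size q) q`_k *: N ^+ k.
  rewrite -{1}[q]coefK poly_def linear_sum; apply: eq_bigr => k _.
  by rewrite linearZ /= rmorphXn /= horner_mx_X.
rewrite /seq_eval; under eq_bigr => k _ do rewrite mulr_sumr.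
rewrite exchange_big; apply: eq_bigr => i _.
under eq_bigr => k _ do rewrite mulr_sumr.
rewrite exchange_big; apply: eq_bigr => j _.
rewrite summxE mulr_sumr; apply: eq_bigr => k _.
by rewrite mxE mulrCA.
Qed.

Lemma exp_sum_mxdot (R : realType) p (A B : 'M[R]_p.+1) : eigenvalues_pos_re B ->
  exp_sum (fun z : R[i] => complex.Re z < 0) (fun k => (mxdot A ((- B) ^+ k))%:C%C).
Proof.
move=> B_pos; pose f := real_complex R; pose N := map_mx f (- B).
have [rs Drs] := closed_field_poly_normal (char_poly N).
move: Drs; rewrite (monicP (char_poly_monic N)) scale1r => Drs.
apply: (@exp_sum_recurrence _ _ rs) => [z rsz|q].
  have: eigenvalue N z by rewrite eigenvalue_root_char Drs root_prod_XsubC.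
  rewrite /N map_mxN eigenvalue_opp => /B_pos.
  by case: z {rsz} => x y /=; rewrite oppr_gt0.
rewrite -Drs [seq_eval _ _](_ : _ =
    seq_eval (fun k => \sum_i \sum_j map_mx f A i j * (N ^+ k) i j) (char_poly N * q)).
  rewrite seq_eval_mx rmorphM /= Cayley_Hamilton mul0r.
  by rewrite big1 // => i _; rewrite big1 // => j _; rewrite [X in _ * X]mxE mulr0.
congr seq_eval; apply/funext => k; rewrite /mxdot (rmorph_sum f).
apply: eq_bigr => i _; rewrite (rmorph_sum f); apply: eq_bigr => j _.
by rewrite (rmorphM f) -(rmorphXn (map_mx f)) !mxE.
Qed.

(** * From exponential sums to the span of the functions u *)

Section Span.
Variable R : realType.
Implicit Types (u v : R -> R).

Definition poly_trig_exp_span (f : R -> R) : Prop :=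
  exists (n : nat) (lam : 'I_n -> R) (u : 'I_n -> R -> R),
    (forall i : 'I_n, poly_trig_exp (u i)) /\
    (forall s : R, 0 <= s -> f s = \sum_(i < n) lam i * u i s).

Lemma poly_trig_exp_span0 : poly_trig_exp_span (fun=> 0).
Proof.
exists 0%N, (fun=> 0), (fun _ _ => 0); split=> [[] //|s _].
by rewrite big_ord0.
Qed.

Lemma poly_trig_exp_span_add l u v : poly_trig_exp u -> poly_trig_exp_span v ->
  poly_trig_exp_span (fun s => l * u s + v s).
Proof.
move=> Pu [n [lam [w [Pw Dv]]]].
exists n.+1, (fun i => oapp lam l (unlift ord0 i)),
  (fun i => oapp w u (unlift ord0 i)); split=> [i|s s0].
  by case: unliftP => [j _|_] /=.
rewrite big_ord_recl unlift_none Dv //=; congr (_ + _).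
by apply: eq_bigr => i _; rewrite liftK.
Qed.

Lemma poly_trig_exp_mono (j : nat) (xi c d r : R) : 0 <= c -> 0 <= d -> 0 < r ->
  poly_trig_exp (fun s =>
    s ^+ j * (1 + c * cos (`|xi| * s) + d * sin (`|xi| * s)) * expR (- (r * s))).
Proof.
move=> c0 d0 r0; exists 'X^j, `|xi|, c, d, r; split=> // s _.
by rewrite hornerXn.
Qed.

(* The required coefficients c, d >= 0 are obtained from
   cos = (1 + cos) - 1 and sin = (1 + sin) - 1. *)
Lemma exp_sum_egf (a : nat -> R[i]) :
    exp_sum (fun z : R[i] => complex.Re z < 0) a ->
  exists2 u, has_egf (fun k => complex.Re (a k)) u & poly_trig_exp_span u.
Proof.
elim=> [|c z j b z_neg _ [v bv Pv]].
  by exists (fun=> 0); [exact: has_egf0 | exact: poly_trig_exp_span0].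
pose x := complex.Re z; pose y := complex.Im z.
(* The sign of [y] goes into [be], since cosine is even and sine is odd; the frequency becomes
   [|y|]. *)
pose al := complex.Re c; pose be := complex.Im c * Num.sg y.
pose T c d := fun s : R =>
  s ^+ j * (1 + c * cos (`|y| * s) + d * sin (`|y| * s)) * expR (- (- x * s)).
have PT (c' d : R) : 0 <= c' -> 0 <= d -> poly_trig_exp (T c' d).
  by move=> c0 d0; apply: poly_trig_exp_mono; rewrite ?oppr_gt0.
exists (fun s => al * T 1 0 s + (- be * T 0 1 s + ((be - al) * T 0 0 s + v s))).
  rewrite (_ : (fun k => _) =
    fun k => complex.Re (c * exp_seq z j k) + complex.Re (b k)); last first.
    by apply/funext => k; rewrite complex_ReD.
  have := has_egfD (has_egf_Re_exp_seq (c := c) (z := z) (j := j)) bv.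
  congr has_egf; apply/funext => s; rewrite -/x -/y -/al.
  have -> : cos (y * s) = cos (`|y| * s).
    by case: (ger0P y) => // _; rewrite mulNr cosN.
  have -> : complex.Im c * sin (y * s) = be * sin (`|y| * s).
    rewrite /be -mulrA; congr (_ * _); have [y0|y0|y0] := ltrgt0P y.
    - by rewrite gtr0_sg // mul1r.
    - by rewrite ltr0_sg // [- y * s]mulNr sinN mulrN mulN1r opprK.
    - by rewrite y0 !mul0r sin0 mulr0.
  by rewrite /T mulNr opprK; ring.
by do 3?apply: poly_trig_exp_span_add => //; apply: PT.
Qed.

End Span.

(** * Realization by a companion matrix *)

Section Realization.
Variable R : realType.
Implicit Types (a : nat -> R) (chi q : {poly R}).

(** Shifting the sequence multiplies the polynomial by ['X], and multiples of [chi] are stable under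
    this. *)
Lemma seq_eval_shift a chi : (forall q, seq_eval a (chi * q) = 0) ->
  forall k q, seq_eval (fun j => a (k + j)%N) (chi * q) = 0.
Proof.
move=> a0; elim=> [|k IHk] q; first exact: a0.
rewrite (_ : (fun j => _) = shift_sub 0 (fun j => a (k + j)%N)).
  by rewrite seq_eval_shift_sub mulrCA IHk.
by apply/funext => j; rewrite /shift_sub mul0r subr0 addSnnS.
Qed.

(** The companion matrix maps the window [v k] of [n] consecutive terms to [v k.+1]: its last row is
    the recurrence, the other rows shift. *)
Lemma companionmx_realization a chi :
    chi \is monic -> (1 < size chi)%N ->
    (forall q, seq_eval a (chi * q) = 0) ->
  exists A : 'M[R]_((size chi).-1), forall k, mxdot A (companionmx chi ^+ k) = a k.
Proof.
move=> chi_monic chi_gt1 a0; set n := (size chi).-1; set N := companionmx chi.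
have n0 : (0 < n)%N by rewrite /n -ltnS prednK // ltnW.
have Dn : size chi = n.+1 by rewrite prednK // ltnW.
pose v k : 'cV[R]_n := \col_j a (k + j)%N.
have Nv k : N *m v k = v k.+1.
  apply/colP => i; rewrite !mxE.
  under eq_bigr => j _ do rewrite !mxE.
  have [Di|ne_i] := altP ((i : nat) =P n.-1).
    have := seq_eval_shift a0 k 1.
    rewrite mulr1 (@seq_eval_widen _ n.+1) ?Dn // big_ord_recr /=.
    have -> : chi`_n = 1 by move/monicP: chi_monic; rewrite /lead_coef Dn.
    rewrite mul1r Di addSnnS prednK // => /eqP; rewrite addrC addr_eq0 => /eqP ->.
    by rewrite -sumrN; apply: eq_bigr => j _; rewrite mulNr.
  have lt_i : (i.+1 < n)%N.
    have : (i <= n.-1)%N by rewrite -ltnS prednK.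
    by rewrite leq_eqVlt (negPf ne_i) /= -ltnS prednK.
  rewrite (bigD1 (Ordinal lt_i)) //= eqxx mul1r big1 ?addr0 ?addSnnS // => j ne_j.
  rewrite (_ : (i.+1 == j :> nat) = false) ?mul0r //; apply/negbTE.
  by apply: contraNneq ne_j => ij; apply/eqP/val_inj.
have Nkv k : N ^+ k *m v 0%N = v k.
  elim: k => [|k IHk]; first by rewrite expr0 -[1]/(1%:M) mul1mx.
  by rewrite exprS -[N * _]/(N *m _) -mulmxA IHk Nv.
(* With [v 0] as first row and zeros elsewhere, the pairing with [N ^+ k] is the first entry of
   [v k]. *)
exists (\matrix_(i, j) (a j *+ (i == Ordinal n0))) => k.
rewrite /mxdot (bigD1 (Ordinal n0)) //= [X in _ + X]big1 ?addr0.
  have := congr1 (fun w : 'cV_n => w (Ordinal n0) ord0) (Nkv k).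
  rewrite !mxE addn0 => <-; apply: eq_bigr => j _.
  by rewrite !mxE eqxx mulr1n mulrC.
move=> i /negPf ne_i; rewrite big1 // => j _.
by rewrite mxE ne_i mulr0n mul0r.
Qed.

(** Since [chi * q] has real coefficients, taking real parts commutes with the functional. *)
Lemma seq_eval_Re_exp_seq (c z : R[i]) j chi q :
    (('X - z%:P) ^+ j.+1 %| map_poly (real_complex R) chi) ->
  seq_eval (fun k => complex.Re (c * exp_seq z j k)) (chi * q) = 0.
Proof.
case/dvdpP => g Dchi; pose f := real_complex R.
transitivity (complex.Re (c * seq_eval (exp_seq z j) (map_poly f (chi * q)))).
  rewrite /seq_eval size_map_poly mulr_sumr.
  elim/big_ind2: _ => // [x1 x2 y1 y2 -> ->|k _]; first by rewrite complex_ReD.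
  by rewrite coef_map [c * (_ * exp_seq _ _ _)]mulrCA [in RHS]complex_ReM /= mul0r subr0.
by rewrite rmorphM /= Dchi [g * _]mulrC -mulrA seq_eval_exp_seq mulr0.
Qed.

End Realization.

(** On s >= 0, u(s) is P(s) times the real part of e^(z0 s) + g e^(z1 s), with g = c - i d. The
    conjugate [z2] of [z1] makes the characteristic polynomial real. *)
Lemma poly_trig_exp_realization (R : realType) (u : R -> R) : poly_trig_exp u ->
  exists (q : nat) (A B : 'M[R]_q),
    [/\ (1 <= q)%N,
        (forall s : R, 0 <= s -> u s = mxdot A (expmx (- (s *: B)))) &
        eigenvalues_pos_re B].
Proof.
move=> [P [xi [c [d [r [_ _ _ r0 Du]]]]]].
pose f := real_complex R.
pose z0 : R[i] := (- r +i* 0)%C; pose z1 : R[i] := (- r +i* xi)%C.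
pose z2 : R[i] := (- r +i* - xi)%C.
pose g : R[i] := (c +i* - d)%C.
(* The multiplicity [m] covers every degree occurring in P; its positivity keeps [chi] nonconstant
   even when P = 0. *)
have [m m0 le_Pm] : exists2 m, (0 < m)%N & (size P <= m)%N by exists (size P).+1.
pose w : {poly R} := ('X + r%:P) * (('X + r%:P) ^+ 2 + (xi * xi)%:P).
have Dw : map_poly f w = ('X - z0%:P) * (('X - z1%:P) * ('X - z2%:P)).
  have Dr : map_poly f ('X + r%:P) = 'X + (f r)%:P.
    by rewrite rmorphD /= map_polyX map_polyC.
  have Dx : map_poly f (xi * xi)%:P = (f (xi * xi))%:P by rewrite map_polyC.
  have -> : map_poly f w = map_poly f ('X + r%:P) *
      (map_poly f ('X + r%:P) ^+ 2 + map_poly f (xi * xi)%:P).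
    by rewrite -rmorphXn -rmorphD -rmorphM.
  rewrite Dr Dx.
  have -> : z0%:P = - (f r)%:P.
    by rewrite -polyCN; congr _%:P; rewrite /f /z0; simpc.
  rewrite opprK; congr (_ * _).
  have -> : z1%:P = - (f r)%:P + (0 +i* xi)%C%:P.
    by rewrite -polyCN -polyCD; congr _%:P; rewrite /f /z1; simpc.
  have -> : z2%:P = - (f r)%:P - (0 +i* xi)%C%:P.
    by rewrite -!polyCN -polyCD; congr _%:P; rewrite /f /z2; simpc.
  have -> : (f (xi * xi))%:P = - (0 +i* xi)%C%:P ^+ 2 :> {poly R[i]}.
    by rewrite -polyC_exp -polyCN; congr _%:P; rewrite /f expr2; simpc.
  ring.
have [chi Dchi] : exists chi : {poly R}, map_poly f chi =
    ('X - z0%:P) ^+ m * (('X - z1%:P) ^+ m * ('X - z2%:P) ^+ m).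
  by exists (w ^+ m); rewrite rmorphXn /= Dw !exprMn.
have chi_monic : chi \is monic.
  by rewrite -(map_monic f) Dchi !rpredM ?rpredX ?monicXsubC.
have chi_gt1 : (1 < size chi)%N.
  rewrite -(size_map_poly f) Dchi !size_Mmonic ?monic_neq0 ?rpredM ?rpredX ?monicXsubC //.
  by rewrite !size_exp_XsubC !addSn /= !addnS ltnS; case: m m0 {le_Pm Dchi chi_monic}.
pose a k := \sum_(i < size P) P`_i * (complex.Re (1 * exp_seq z0 i k) +
                                      complex.Re (g * exp_seq z1 i k)).
have a0 q : seq_eval a (chi * q) = 0.
  transitivity (\sum_(i < size P) P`_i * (
      seq_eval (fun k => complex.Re (1 * exp_seq z0 i k)) (chi * q) +
      seq_eval (fun k => complex.Re (g * exp_seq z1 i k)) (chi * q))).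
    rewrite /seq_eval; under eq_bigr => k _ do rewrite mulr_sumr.
    rewrite exchange_big; apply: eq_bigr => i _.
    rewrite -big_split mulr_sumr; apply: eq_bigr => k _.
    by rewrite /= mulrCA mulrDr.
  apply: big1 => i _; have le_im : (i.+1 <= m)%N by rewrite (leq_trans _ le_Pm).
  have d0 : ('X - z0%:P) ^+ i.+1 %| map_poly f chi.
    by rewrite Dchi dvdp_mulr // dvdp_exp2l.
  have d1 : ('X - z1%:P) ^+ i.+1 %| map_poly f chi.
    by rewrite Dchi; apply/dvdp_mull/dvdp_mulr/dvdp_exp2l.
  rewrite [X in _ * (X + _)](seq_eval_Re_exp_seq 1 q d0).
  by rewrite [X in _ * (_ + X)](seq_eval_Re_exp_seq g q d1) addr0 mulr0.
have [A DA] := companionmx_realization chi_monic chi_gt1 a0.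
exists (size chi).-1, A, (- companionmx chi); split.
- by rewrite -ltnS prednK // ltnW.
- move=> s s0; rewrite scalerN opprK Du //.
  have hA : has_egf a (fun s => mxdot A (expmx (s *: companionmx chi))).
    have := has_egf_mxdot (A := A) (N := companionmx chi).
    by congr has_egf; apply/funext.
  have h : has_egf a _ := has_egf_sum (fun i : 'I_(size P) => has_egfZ (c := P`_i)
    (has_egfD (has_egf_Re_exp_seq (c := 1) (z := z0) (j := i))
              (has_egf_Re_exp_seq (c := g) (z := z1) (j := i)))).
  rewrite -(has_egf_unique s h hA) /=.
  rewrite horner_coef !mulr_suml; apply: eq_bigr => i _.
  by rewrite mul0r sin0 cos0 mulNr; ring.
(* Here [- z] is a root of [chi], so it is [z0], [z1] or [z2], and [z] has real part [r]. *)
- move=> z; rewrite map_mxN eigenvalue_opp eigenvalue_root_char -map_char_poly.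
  rewrite companionmxK // Dchi !rootM -(prednK m0) !root_exp_XsubC.
  by case: z => x y /orP[|/orP[]] /eqP[/eqP] /=; rewrite eqr_opp => /eqP ->.
Qed.

Theorem proposition3p1 (R : realType) :
  (forall (f : R -> R) (p : nat) (A B : 'M[R]_p),
     (1 <= p)%N ->
     (forall s : R, 0 <= s -> 0 <= f s) ->
     (forall s : R, 0 <= s -> f s = mxdot A (expmx (- (s *: B)))) ->
     eigenvalues_pos_re B ->
     exists (n : nat) (lam : 'I_n -> R) (u : 'I_n -> R -> R),
       (forall i : 'I_n, poly_trig_exp (u i)) /\
       (forall s : R, 0 <= s -> f s = \sum_(i < n) lam i * u i s))
  /\
  (forall u : R -> R,
     poly_trig_exp u ->
     exists (q : nat) (A B : 'M[R]_q),
       [/\ (1 <= q)%N,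
           (forall s : R, 0 <= s -> u s = mxdot A (expmx (- (s *: B)))) &
           eigenvalues_pos_re B]).
Proof.
split; last exact: poly_trig_exp_realization.
move=> f [//|p] A B _ _ Df B_pos.
have [u au [n [lam [w [Pw Du]]]]] := exp_sum_egf (exp_sum_mxdot A B_pos).
exists n, lam, w; split=> // s s0; rewrite -Du // Df // -scalerN.
(* Both functions have the same coefficients, as the real part of an embedded real number reduces to
   that number. *)
exact: has_egf_unique (has_egf_mxdot (A := A) (N := - B)) au.
Qed.
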